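(* Let $L$ be a distributive lattice. Then $L$ is infinitely distributive if and only if $\mathfrak{u}$O-convergence on $L$ is order continuous, i.e. if and only if for every net $(x_\gamma)_{\gamma\in\Gamma}$ in $L$ and every $x\in L$, if $(x_\gamma)_{\gamma\in\Gamma}$ O-converges to $x$ then $(x_\gamma)_{\gamma\in\Gamma}$ $\mathfrak{u}$O-converges to $x$.
   Context: A subset of a poset is directed (resp. filtered) if it is non-empty and each of its finite subsets has an upper bound (resp. lower bound) in it. A net $(x_\gamma)_{\gamma\in\Gamma}$ in a lattice $L$ O-converges to $x\in L$ if there exist a directed set $M\subseteq L$ and a filtered set $N\subseteq L$ with $\bigvee M=\bigwedge N=x$ such that for every $(m,n)\in M\times N$ there is $\gamma_0\in\Gamma$ with $m\le x_\gamma\le n$ for all $\gamma\ge\gamma_0$. The net $\mathfrak{u}$O-converges to $x$ if the net $((x_\gamma\wedge t)\vee s)_{\gamma\in\Gamma}$ O-converges to $(x\wedge t)\vee s$ for every $s,t\in L$ with $s\le t$. A lattice $L$ is infinitely distributive if for every $x\in L$ and every family $\{x_\alpha\}_{\alpha\in\mathcal A}\subseteq L$: whenever $\bigwedge_\alpha x_\alpha$ exists in $L$, $x\vee\bigwedge_\alpha x_\alpha=\bigwedge_\alpha(x\vee x_\alpha)$; and whenever $\bigvee_\alpha x_\alpha$ exists in $L$, $x\wedge\bigvee_\alpha x_\alpha=\bigvee_\alpha(x\wedge x_\alpha)$ (the right-hand sides being asserted to exist). *)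

(* Defs.v *)
From HB Require Import structures.
From mathcomp Require Import all_boot all_order.
From mathcomp Require Import boolp classical_sets functions cardinality.

Set Implicit Arguments.
Unset Strict Implicit.
Unset Printing Implicit Defensive.

Import Order.Theory.

Local Open Scope classical_set_scope.
Local Open Scope order_scope.

(* Stated on preorders so that it also applies to the index sets of nets;
   upper bounds are spelled out because [ubound] requires a [porderType]. *)
Definition directed (d : Order.disp_t) (T : preorderType d) (D : set T) : Prop :=
  D !=set0 /\
  forall F : set T, finite_set F -> F `<=` D ->
    exists2 u, D u & forall x, F x -> x <= u.

Definition filtered (d : Order.disp_t) (T : preorderType d) (D : set T) : Prop :=
  D !=set0 /\
  forall F : set T, finite_set F -> F `<=` D ->
    exists2 l, D l & forall x, F x -> l <= x.

(* [supremums M x] says that the supremum of [M] exists and equals [x]: the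
   total functions [supremum] and [infimum] return a default value when there
   is no supremum or infimum, so they cannot assert existence. *)
Definition O_converges (d d' : Order.disp_t) (L : latticeType d)
    (G : preorderType d') (u : G -> L) (x : L) : Prop :=
  exists M N : set L,
    [/\ directed M, filtered N, supremums M x, infimums N x &
      forall m n, M m -> N n ->
        exists g0 : G, forall g, g0 <= g -> m <= u g <= n].

Definition uO_converges (d d' : Order.disp_t) (L : latticeType d)
    (G : preorderType d') (u : G -> L) (x : L) : Prop :=
  forall s t : L, s <= t ->
    O_converges (fun g => (u g `&` t) `|` s) ((x `&` t) `|` s).

Definition infinitely_distributive (d : Order.disp_t) (L : latticeType d) : Prop :=
  forall (x : L) (A : Type) (f : A -> L),
    (forall y, infimums (range f) y ->
       infimums (range (fun a => x `|` f a)) (x `|` y)) /\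
    (forall y, supremums (range f) y ->
       supremums (range (fun a => x `&` f a)) (x `&` y)).

(* Main.v *)
From HB Require Import structures.
Require Import Defs.
From mathcomp Require Import all_boot all_order.
From mathcomp Require Import boolp classical_sets functions cardinality.

Set Implicit Arguments.
Unset Strict Implicit.
Unset Printing Implicit Defensive.

Import Order.Theory.

Local Open Scope classical_set_scope.
Local Open Scope order_scope.

(** Write [tr a] for the truncation [(a `&` t) `|` s], with [s <= t].

    If [L] is infinitely distributive and [M], [N] witness that a net [u]
    O-converges to [x], then the images [tr @` M] and [tr @` N] witness that
    [tr \o u] O-converges to [tr x]. As [tr] is monotone, directedness and the
    eventual bounds carry over, and only the supremum and the infimum of the
    images have to be computed. The supremum goes through [a `&` t] by infinite
    distributivity and through [_ `|` s] in any lattice, because [M] is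
    non-empty; the infimum is the same computation in the dual lattice, where
    [tr] reads [(a `|` s) `&` t], an equal expression by distributivity.

    Conversely, let [y] be the supremum of a non-empty set [A], let [x] be in
    [L], and let [b] bound [x `&` a] for all [a] in [A]; one has to see that
    [x `&` y <= b]. The set [M] of those [m <= y] with [x `&` m <= b] is an
    ideal, by distributivity, and contains [A]; hence it is directed with
    supremum [y], and the inclusion of [M] in [L], as a net indexed by [M],
    O-converges to [y]. By hypothesis its truncation between [a0 `&` x] and
    [x], for any [a0] in [A], O-converges to the truncation of [y], which is
    [x `&` y]; but this truncated net stays below [b], and a limit of a net
    bounded by [b] is itself bounded by [b]. So [x `&` y <= b]. The other
    distributive law follows by duality, since O-convergence is self-dual. *)

Lemma directed_pairwise (d : Order.disp_t) (T : preorderType d) (D : set T) :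
  directed D <->
  D !=set0 /\ forall a b, D a -> D b -> exists2 c, D c & a <= c /\ b <= c.
Proof.
split=> -[D0 Dub]; split=> //.
  move=> a b Da Db; have [||c Dc cub] := Dub [set a; b].
  - by rewrite finite_setU; split; exact: finite_set1.
  - by move=> z [->|->].
  - by exists c => //; split; apply: cub; [left|right].
move=> F /finite_seqP[s ->]; elim: s => [|a s IHs] sD.
  by have [u Du] := D0; exists u.
have [u Du su] : exists2 u, D u & forall z, [set` s] z -> z <= u.
  by apply: IHs => z zs; apply: sD; rewrite /= inE zs orbT.
have [|c Dc [ac uc]] := Dub a u _ Du; first by apply: sD; rewrite /= inE eqxx.
exists c => // z /=; rewrite inE => /orP[/eqP->//|zs].
exact: le_trans (su z zs) uc.
Qed.

Lemma directed_image (d d' : Order.disp_t) (T : preorderType d)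
    (T' : preorderType d') (f : T -> T') (D : set T) :
  {homo f : a b / a <= b} -> directed D -> directed (f @` D).
Proof.
move=> homo_f /directed_pairwise[[a0 Da0] Dub]; apply/directed_pairwise; split.
  by exists (f a0), a0.
move=> _ _ [a Da <-] [b Db <-]; have [c Dc [ac bc]] := Dub a b Da Db.
by exists (f c); [exists c | split; exact: homo_f].
Qed.

(** One half of infinite distributivity, with sets in place of families; the
    other half is this property of the dual lattice [L^d]. *)
Definition sup_distributive (d : Order.disp_t) (L : latticeType d) : Prop :=
  forall (x : L) (A : set L) (y : L), supremums A y ->
    supremums ((fun a => x `&` a) @` A) (x `&` y).

Lemma infinitely_distributive_sup (d : Order.disp_t) (L : latticeType d) :
  infinitely_distributive L <-> sup_distributive L /\ sup_distributive L^d.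
Proof.
have rangeE (g : L -> L) (A : Type) (f : A -> L) :
  range (fun a => g (f a)) = g @` range f by rewrite -image_comp.
have rangeK (A : set L) : range (fun a : {a | A a} => sval a) = A.
  by apply/seteqP; split=> [_ [[a Aa] _ <-]//|a Aa]; exists (exist _ a Aa).
split=> [Linf|[Lsup Linf] x A f]; first split=> x A y Ay.
- by have [_] := Linf x _ (fun a : {a | A a} => sval a);
  rewrite rangeE rangeK; exact.
- by have [+ _] := Linf x _ (fun a : {a | A a} => sval a);
  rewrite rangeE rangeK; exact.
by split=> y fy; rewrite rangeE; [exact: Linf | exact: Lsup].
Qed.

(** Non-emptiness matters: for empty [A] the supremum [y] is the bottom element
    and the image is empty as well, with supremum [y], whereas [y `|` s] is
    [s]. *)
Lemma supremums_joinl (d : Order.disp_t) (L : latticeType d) (s : L)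
    (A : set L) (y : L) : A !=set0 -> supremums A y ->
  supremums ((fun a => a `|` s) @` A) (y `|` s).
Proof.
move=> [a0 Aa0] [yub ylub]; split.
  by move=> _ [a Aa <-]; rewrite leU2// yub.
move=> b bub; rewrite leUx ylub /=.
  by have := bub _ (imageP _ Aa0); rewrite leUx => /andP[].
by move=> a Aa; have := bub _ (imageP _ Aa); rewrite leUx => /andP[].
Qed.

Lemma supremums_truncation (d : Order.disp_t) (L : latticeType d) (s t : L)
    (A : set L) (y : L) : sup_distributive L -> A !=set0 -> supremums A y ->
  supremums ((fun a => (a `&` t) `|` s) @` A) ((y `&` t) `|` s).
Proof.
move=> Lsup A0 /(Lsup t) Ay; rewrite meetC.
rewrite (_ : _ @` A = (fun a => a `|` s) @` ((fun a => t `&` a) @` A)); last first.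
  by rewrite image_comp; apply: eq_imagel => a _ /=; rewrite meetC.
by apply: supremums_joinl Ay; have [a Aa] := A0; exists (t `&` a), a.
Qed.

(** The truncation between [s] and [t] is a self-dual operation, which is what
    lets each direction of the equivalence be proved on one side only. *)
Lemma truncation_swap (d : Order.disp_t) (L : distrLatticeType d) (s t a : L) :
  s <= t -> (a `&` t) `|` s = (a `|` s) `&` t.
Proof. by move=> st; rewrite joinIl (join_l st). Qed.

Definition O_continuous (d : Order.disp_t) (L : latticeType d) : Prop :=
  forall (d' : Order.disp_t) (G : preorderType d'), directed [set: G] ->
    forall (u : G -> L) (x : L), O_converges u x -> uO_converges u x.

Lemma sup_distributive_continuous (d : Order.disp_t) (L : distrLatticeType d) :
  sup_distributive L -> sup_distributive L^d -> O_continuous L.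
Proof.
move=> Lsup Linf d' G _ u x [M [N [dirM filN Mx Nx MNu]]] s t st.
have trunc_homo : {homo (fun a : L => (a `&` t) `|` s) : a b / a <= b}.
  by move=> a b ab; rewrite leU2// leI2.
exists ((fun m => (m `&` t) `|` s) @` M), ((fun n => (n `&` t) `|` s) @` N).
split.
- exact: directed_image trunc_homo dirM.
- apply: (@directed_image _ _ L^d L^d (fun n : L => (n `&` t) `|` s) N _ filN).
  by move=> a b; exact: (trunc_homo b a).
- exact: supremums_truncation Lsup dirM.1 Mx.
- rewrite truncation_swap//.
  (* In [L^d] the roles of [s] and [t] are exchanged. *)
  rewrite (_ : _ @` N = (fun n => (n `|` s) `&` t) @` N); last first.
    by apply: eq_imagel => n _; exact: truncation_swap.
  exact: (@supremums_truncation _ L^d t s N x Linf filN.1 Nx).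
- move=> _ _ [m Mm <-] [n Nn <-]; have [g0 ug0] := MNu m n Mm Nn.
  by exists g0 => g /ug0/andP[mu un]; rewrite !(leU2, leI2).
Qed.

Lemma O_converges_dual (d d' : Order.disp_t) (L : latticeType d)
    (G : preorderType d') (u : G -> L) (x : L) :
  @O_converges _ _ L^d G u x <-> O_converges u x.
Proof.
by split=> -[M [N [dirM filN Mx Nx MNu]]]; exists N, M;
  split=> // n m Nn Mm; have [g0 ug0] := MNu m n Mm Nn;
  exists g0 => g /ug0; rewrite andbC.
Qed.

Lemma O_continuous_dual (d : Order.disp_t) (L : distrLatticeType d) :
  O_continuous L -> O_continuous L^d.
Proof.
move=> Lcont d' G dirG u x /O_converges_dual/(Lcont _ _ dirG) ux s t ts.
apply/O_converges_dual; have := ux t s ts.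
rewrite truncation_swap//; congr O_converges.
by apply/funext => g; exact: truncation_swap.
Qed.

(* A directed set [M] is made an index set of nets by giving [set_type M] the
   induced order. *)
HB.instance Definition _ (d : Order.disp_t) (T : porderType d) (M : set T) :=
  SubChoice.copy (set_type M) {x | x \in M}.
HB.instance Definition _ (d : Order.disp_t) (T : porderType d) (M : set T) :=
  [SubChoice_isSubPOrder of set_type M by <: with d].

Lemma directed_set_type (d : Order.disp_t) (T : porderType d) (M : set T) :
  directed M -> directed [set: set_type M].
Proof.
move=> /directed_pairwise[[m0 Mm0] Mub]; apply/directed_pairwise; split.
  by exists (SigSub (mem_set Mm0)).
move=> a b _ _; have [c Mc [ac bc]] := Mub _ _ (set_valP a) (set_valP b).
by exists (SigSub (mem_set Mc)).
Qed.

Lemma O_converges_inclusion (d : Order.disp_t) (L : latticeType d) (M : set L)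
    (y : L) : directed M -> supremums M y ->
  O_converges (fun m : set_type M => val m) y.
Proof.
move=> dirM My; exists M, [set y]; split=> //.
- by split=> [|F _ Fy]; exists y => // a /Fy ->.
- by rewrite infimums1.
- move=> m _ Mm ->; exists (SigSub (mem_set Mm)) => g mg.
  by apply/andP; split; [exact: mg | apply: My.1; exact: set_valP].
Qed.

(** The net to test is the inclusion of a directed set with the same supremum as
    [A]. The finite joins of elements of [A] would do, but an ideal that depends
    on the bound [b] is directed by a one-line argument, with no induction. *)
Lemma continuous_sup_distributive (d : Order.disp_t) (L : distrLatticeType d) :
  O_continuous L -> sup_distributive L.
Proof.
move=> Lcont x A y [yub ylub]; split.
  by move=> _ [a Aa <-]; rewrite leI2// yub.
move=> b bub; have [A0|/set0P[a0 Aa0]] := eqVneq A set0.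
  (* Here [y] is the bottom element. *)
  by apply: le_trans (leIr _ _) (ylub _ _); rewrite A0.
pose M := [set m | m <= y /\ x `&` m <= b].
have AM : A `<=` M by move=> a Aa; split; [exact: yub | exact/bub/imageP].
have dirM : directed M.
  apply/directed_pairwise; split; first by exists a0; exact: AM.
  move=> m n [my mb] [ny nb]; exists (m `|` n).
    by split; [rewrite leUx my | rewrite meetUr leUx mb].
  by rewrite leUl leUr.
have My : supremums M y.
  by split=> [m []//|c cub]; apply: ylub => a /AM; exact: cub.
have := Lcont _ _ (directed_set_type dirM) _ _ (O_converges_inclusion dirM My).
(* Truncating between [a0 `&` x] and [x] turns [m] into
   [(m `&` x) `|` (a0 `&` x)], which is below [b] for [m] in [M], and turns [y]
   into [y `&` x]. *)
move=> /(_ (a0 `&` x) x (leIr _ _))[M' [N' [_ [[n N'n] _] [_ lubM'] _ MNu]]].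
have yx : x `&` y <= (y `&` x) `|` (a0 `&` x) by rewrite meetC leUl.
apply: le_trans yx _; apply: lubM' => m M'm.
have [g /(_ g (lexx g))/andP[mg _]] := MNu m n M'm N'n.
apply: le_trans mg _; rewrite leUx -!(meetC x).
have [_ ->] := set_valP g; by have [_ ->] := AM _ Aa0.
Qed.

Theorem theorem7 (d : Order.disp_t) (L : distrLatticeType d) :
  infinitely_distributive L <->
  (forall (d' : Order.disp_t) (G : preorderType d'), directed [set: G]%classic ->
     forall (u : G -> L) (x : L), O_converges u x -> uO_converges u x).
Proof.
apply: (iff_trans (infinitely_distributive_sup L)); split.
  by move=> [Lsup Linf]; exact: sup_distributive_continuous.
move=> Lcont; split; first exact: continuous_sup_distributive.
exact/continuous_sup_distributive/O_continuous_dual.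
Qed.
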